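(* Let $r>0$ and let $b,c,d,k:\mathbb{R}\to\mathbb{R}$ be continuously differentiable, with $k$ not a constant function. Then the neutral differential equation $$x''(t)+b(t)x'(t-r)+c(t)x(t)+d(t)x(t-r)+k(t)x''(t-r)=0$$ admits a two dimensional group generated by $$\zeta_1^*=x\frac{\partial}{\partial x},\qquad \zeta_2^*=\rho(t)\frac{\partial}{\partial x},$$ where $\rho$ is an arbitrary solution of the same equation.
   Context: Admitted generators. Put $\omega^r=\omega(t-r,y)$, $\Upsilon^r=\Upsilon(t-r,y)$, with $y,q,s$ standing for $x(t-r),x'(t-r),x''(t-r)$ and $p$ for $x'(t)$. For smooth functions $\omega(t,x),\Upsilon(t,x)$, the vector field $\zeta^*=\omega\,\partial/\partial t+\Upsilon\,\partial/\partial x$ is an infinitesimal generator admitted by the equation $x''(t)+b(t)x'(t-r)+c(t)x(t)+d(t)x(t-r)+k(t)x''(t-r)=0$ if the following two conditions hold identically in the independent variables $t,x,p,y,q,s$: (i) $\omega(t-r,y)=\omega(t,x)$ (invariance of the delay relation); (ii) $\Upsilon_{[tt]}+b\,\Upsilon^r_{[t]}+c\,\Upsilon+d\,\Upsilon^r+k\,\Upsilon^r_{[tt]}+\omega\,(b'q+c'x+d'y+k's)=0$, where $\Upsilon_{[tt]}=\Upsilon_{tt}+(2\Upsilon_{tx}-\omega_{tt})p+(\Upsilon_{xx}-2\omega_{tx})p^2-\omega_{xx}p^3+(\Upsilon_x-2\omega_t)X-3\omega_x pX$ with $X=-(bq+cx+dy+ks)$ and derivatives evaluated at $(t,x)$;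 $\Upsilon^r_{[t]}=\Upsilon_t+(\Upsilon_x-\omega_t)q-\omega_xq^2$ and $\Upsilon^r_{[tt]}=\Upsilon_{tt}+(2\Upsilon_{tx}-\omega_{tt})q+(\Upsilon_{xx}-2\omega_{tx})q^2-\omega_{xx}q^3+(\Upsilon_x-2\omega_t)s-3\omega_xqs$ with derivatives of $\omega,\Upsilon$ evaluated at $(t-r,y)$. Saying that the equation admits an $n$-dimensional group generated by listed vector fields $\zeta^*_1,\dots,\zeta^*_n$, one of which is $\rho(t)\partial/\partial x$, means that the admitted generators are exactly the real linear combinations of the listed fields, with $\rho$ ranging over all solutions of the equation (the family $\rho(t)\partial/\partial x$ is counted as one dimension). *)

(* Defs.v *)
From Stdlib Require Import Reals.
From Coquelicot Require Import Coquelicot.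

Open Scope R_scope.

Definition cont_diff (f : R -> R) : Prop :=
  forall t, ex_derive f t /\ continuous (Derive f) t.

(* [ex_diff_n f n t x]: all partial derivatives of [f] of order at most [n],
   in any order of differentiation, exist and are continuous at [(t, x)]. *)
Definition smooth2 (f : R -> R -> R) : Prop :=
  forall n t x, ex_diff_n f n t x.

(* Classical solutions on the whole line.  Both differentiability clauses are
   needed: [Derive] is total, so [ex_derive (Derive rho) t] does not imply
   [ex_derive rho t]. *)
Definition is_solution (r : R) (b c d k : R -> R) (rho : R -> R) : Prop :=
  (forall t, ex_derive rho t /\ ex_derive (Derive rho) t) /\
  (forall t,
     Derive_n rho 2 t + b t * Derive rho (t - r) + c t * rho t
     + d t * rho (t - r) + k t * Derive_n rho 2 (t - r) = 0).

(* The vector field [tcoef * d/dt + xcoef * d/dx] on the [(t, x)] plane. *)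
Record vfield := VField { tcoef : R -> R -> R; xcoef : R -> R -> R }.

Definition smooth_vfield (V : vfield) : Prop :=
  smooth2 (tcoef V) /\ smooth2 (xcoef V).

Definition vf_eq (V W : vfield) : Prop :=
  forall t x, tcoef V t x = tcoef W t x /\ xcoef V t x = xcoef W t x.

Definition vf_add (V W : vfield) : vfield :=
  VField (fun t x => tcoef V t x + tcoef W t x)
         (fun t x => xcoef V t x + xcoef W t x).

Definition vf_scal (a : R) (V : vfield) : vfield :=
  VField (fun t x => a * tcoef V t x) (fun t x => a * xcoef V t x).

(* [partial_derive i j f t x] differentiates [i] times in the first variable
   [t] and [j] times in the second variable [x]. *)

(* Coefficient of the first prolongation of [V]; [p] stands for [x'].  The
   delayed coefficient is its value at the point [(t - r, y)], with [q] for
   [x'(t - r)]. *)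
Definition prol1 (V : vfield) (t x p : R) : R :=
  let w := tcoef V in
  let U := xcoef V in
  partial_derive 1 0 U t x
  + (partial_derive 0 1 U t x - partial_derive 1 0 w t x) * p
  - partial_derive 0 1 w t x * p ^ 2.

(* Coefficient of the second prolongation; [p] and [z] stand for [x'] and
   [x'']. *)
Definition prol2 (V : vfield) (t x p z : R) : R :=
  let w := tcoef V in
  let U := xcoef V in
  partial_derive 2 0 U t x
  + (2 * partial_derive 1 1 U t x - partial_derive 2 0 w t x) * p
  + (partial_derive 0 2 U t x - 2 * partial_derive 1 1 w t x) * p ^ 2
  - partial_derive 0 2 w t x * p ^ 3
  + (partial_derive 0 1 U t x - 2 * partial_derive 1 0 w t x) * z
  - 3 * partial_derive 0 1 w t x * p * z.

Definition delay_invariant (r : R) (V : vfield) : Prop :=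
  forall t x y, tcoef V (t - r) y = tcoef V t x.

(* [y], [q], [s] stand for [x(t - r)], [x'(t - r)], [x''(t - r)]; the equation
   is used to replace [x''(t)] by [X]. *)
Definition determining_equation (r : R) (b c d k : R -> R) (V : vfield) : Prop :=
  forall t x p y q s,
    let X := - (b t * q + c t * x + d t * y + k t * s) in
    prol2 V t x p X
    + b t * prol1 V (t - r) y q
    + c t * xcoef V t x
    + d t * xcoef V (t - r) y
    + k t * prol2 V (t - r) y q s
    + tcoef V t x
      * (Derive b t * q + Derive c t * x + Derive d t * y + Derive k t * s) = 0.

Definition admitted_generator (r : R) (b c d k : R -> R) (V : vfield) : Prop :=
  delay_invariant r V /\ determining_equation r b c d k V.

Definition zeta1 : vfield := VField (fun _ _ => 0) (fun _ x => x).

Definition zeta2 (rho : R -> R) : vfield :=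
  VField (fun _ _ => 0) (fun t _ => rho t).

(* Main.v *)
(* Invariance of the delay relation forces the [d/dt]-coefficient to be an
   [r]-periodic function [w] of [t] alone.  Splitting the determining equation
   by powers of [p], [s] and [x] gives [Y = al(t) x + be(t)] for the
   [d/dx]-coefficient, then [2 al' = w''], [w k' = 0] and
   [al'' + 2 c w' + c' w = 0].  Since [k] is not constant, [w] vanishes on some
   interval, so the linear third-order equation [w''' + 4 c w' + 2 c' w = 0]
   makes [w] vanish identically.  Hence [al] is constant, and [be] solves the
   equation. *)
Require Import Defs.
From Stdlib Require Import Reals Lra Classical FunctionalExtensionality.
From Coquelicot Require Import Coquelicot.

Open Scope R_scope.

(** * Uniqueness of the zero solution for a linear third-order equation *)

Lemma eq_of_Derive_zero (f : R -> R) :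
  (forall t, ex_derive f t) -> (forall t, Derive f t = 0) ->
  forall a b, f a = f b.
Proof.
intros Hex H0 a b.
destruct (MVT_gen f a b (Derive f)) as [z [_ Hz]].
- intros x _. apply Derive_correct, Hex.
- intros x _. apply derivable_continuous_pt, ex_derive_Reals_0, Hex.
- rewrite H0 in Hz. lra.
Qed.

(** For a suitable constant [L], the product [E t * exp (- L * t)] does not grow on the way from [a]
    to [b], whichever endpoint is larger. It starts at 0 and is nonnegative, so it ends at 0. *)
Lemma gronwall_zero (E E' : R -> R) (K a b : R) :
  (forall t, is_derive E t (E' t)) -> (forall t, 0 <= E t) ->
  (forall t, Rmin a b <= t <= Rmax a b -> Rabs (E' t) <= K * E t) ->
  E a = 0 -> E b = 0.
Proof.
intros HE Hpos HK Ha.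
assert (key : forall L,
  (forall t, Rmin a b <= t <= Rmax a b -> (E' t - L * E t) * (b - a) <= 0) ->
  E b = 0).
{ intros L HL.
  assert (HD : forall t, is_derive (fun t => E t * exp (- L * t)) t
                 ((E' t - L * E t) * exp (- L * t))).
  { intros t. auto_derive.
    - exists (E' t). apply HE.
    - replace (Derive (fun x => E x) t) with (E' t)
        by (symmetry; apply is_derive_unique, HE).
      ring. }
  destruct (MVT_gen _ a b _ (fun t _ => HD t)) as [z [Hz Heq]].
  { intros x _. apply derivable_continuous_pt, ex_derive_Reals_0.
    eexists. exact (HD x). }
  rewrite Ha in Heq.
  specialize (HL z Hz).
  pose proof (exp_pos (- L * z)). pose proof (exp_pos (- L * b)).
  specialize (Hpos b).
  nra. }
(* Moving to the right uses [E' <= K * E], moving to the left uses [E' >= - K * E]. *)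
destruct (Rle_dec a b) as [Hab | Hab].
- apply (key K). intros t Ht. specialize (HK t Ht).
  pose proof (Rle_abs (E' t)). nra.
- apply (key (- K)). intros t Ht. specialize (HK t Ht).
  pose proof (Rabs_maj2 (E' t)). nra.
Qed.

(** The energy [w0 ^ 2 + w1 ^ 2 + w2 ^ 2] vanishes at [a]. Continuity bounds [p] and [q] between [a]
    and [b], and [2uv <= u ^ 2 + v ^ 2] then bounds the derivative of the energy by [2 + P + Q]
    times the energy, so [gronwall_zero] applies. *)
Lemma third_order_linear_zero (w0 w1 w2 p q : R -> R) (a : R) :
  (forall t, is_derive w0 t (w1 t)) -> (forall t, is_derive w1 t (w2 t)) ->
  (forall t, is_derive w2 t (p t * w1 t + q t * w0 t)) ->
  (forall t, continuous p t) -> (forall t, continuous q t) ->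
  w0 a = 0 -> w1 a = 0 -> w2 a = 0 -> forall b, w0 b = 0.
Proof.
intros H0 H1 H2 Cp Cq Z0 Z1 Z2 b.
destruct (bounded_continuity p (Rmin a b) (Rmax a b) (fun t _ => Cp t)) as [P HP].
destruct (bounded_continuity q (Rmin a b) (Rmax a b) (fun t _ => Cq t)) as [Q HQ].
assert (HE : w0 b ^ 2 + w1 b ^ 2 + w2 b ^ 2 = 0).
{ apply (gronwall_zero (fun t => w0 t ^ 2 + w1 t ^ 2 + w2 t ^ 2)
    (fun t => 2 * w0 t * w1 t + 2 * w1 t * w2 t
              + 2 * w2 t * (p t * w1 t + q t * w0 t)) (2 + P + Q) a b).
  - intros t. auto_derive.
    + repeat split; eexists; eauto.
    + replace (Derive (fun x => w0 x) t) with (w1 t)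
        by (symmetry; apply is_derive_unique, H0).
      replace (Derive (fun x => w1 x) t) with (w2 t)
        by (symmetry; apply is_derive_unique, H1).
      replace (Derive (fun x => w2 x) t) with (p t * w1 t + q t * w0 t)
        by (symmetry; apply is_derive_unique, H2).
      ring.
  - intros t. nra.
  - intros t Ht.
    specialize (HP t Ht). specialize (HQ t Ht).
    change (Rabs (p t) < P) in HP. change (Rabs (q t) < Q) in HQ.
    apply Rabs_def2 in HP. apply Rabs_def2 in HQ.
    generalize (w0 t) (w1 t) (w2 t) (p t) (q t) HP HQ. clear.
    intros x y z m n HP HQ.
    assert (prod : forall u v e B, e < B /\ - B < e ->
              Rabs (2 * u * v * e) <= B * (u ^ 2 + v ^ 2)).
    { intros u v e B HB. apply Rabs_le.
      pose proof (pow2_ge_0 (u + v)). pose proof (pow2_ge_0 (u - v)).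
      split; nra. }
    pose proof (prod z y m P HP). pose proof (prod z x n Q HQ).
    assert (Rabs (2 * x * y) <= x ^ 2 + y ^ 2).
    { apply Rabs_le. pose proof (pow2_ge_0 (x + y)).
      pose proof (pow2_ge_0 (x - y)). split; nra. }
    assert (Rabs (2 * y * z) <= y ^ 2 + z ^ 2).
    { apply Rabs_le. pose proof (pow2_ge_0 (y + z)).
      pose proof (pow2_ge_0 (y - z)). split; nra. }
    replace (2 * x * y + 2 * y * z + 2 * z * (m * y + n * x))
      with (2 * x * y + 2 * y * z + (2 * z * y * m + 2 * z * x * n)) by ring.
    eapply Rle_trans; [apply Rabs_triang |].
    eapply Rle_trans;
      [apply Rplus_le_compat; apply Rabs_triang |].
    assert (0 <= P) by lra. assert (0 <= Q) by lra.
    pose proof (pow2_ge_0 x). pose proof (pow2_ge_0 y).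
    pose proof (pow2_ge_0 z). nra.
  - rewrite Z0, Z1, Z2. ring. }
nra.
Qed.

(** * Smooth functions of two variables *)

Lemma smooth2_dt (f : R -> R -> R) :
  smooth2 f -> smooth2 (fun t x => Derive (fun z => f z x) t).
Proof. intros H n t x. apply (H (S n) t x). Qed.

Lemma smooth2_dx (f : R -> R -> R) :
  smooth2 f -> smooth2 (fun t x => Derive (fun z => f t z) x).
Proof. intros H n t x. apply (H (S n) t x). Qed.

Lemma smooth2_ex_dt (f : R -> R -> R) (x t : R) :
  smooth2 f -> ex_derive (fun z => f z x) t.
Proof. intros H. apply (H 1%nat t x). Qed.

Lemma smooth2_ex_dx (f : R -> R -> R) (t x : R) :
  smooth2 f -> ex_derive (fun z => f t z) x.
Proof. intros H. apply (H 1%nat t x). Qed.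

Lemma smooth2_affine (f : R -> R -> R) :
  smooth2 f -> (forall t x, partial_derive 0 2 f t x = 0) ->
  forall t x, f t x = Derive (f t) 0 * x + f t 0.
Proof.
intros Hf H t x.
assert (slope : forall z, Derive (f t) z = Derive (f t) 0).
{ intros z. apply (eq_of_Derive_zero (Derive (f t))).
  - intros y. apply (smooth2_ex_dx _ t y (smooth2_dx f Hf)).
  - intros y. apply (H t y). }
set (m := Derive (f t) 0) in *.
(* The slope in [x] is the constant [m], so subtracting [m * x] leaves a function with zero
   derivative. *)
assert (E : f t x - m * x = f t 0 - m * 0).
{ apply (eq_of_Derive_zero (fun z => f t z - m * z)); intros z.
  - apply (ex_derive_minus (f t) (fun z => m * z)).
    + apply smooth2_ex_dx, Hf.
    + auto_derive; easy.
  - rewrite (Derive_minus (f t) (fun z => m * z)).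
    + rewrite slope, Derive_scal, Derive_id. ring.
    + apply smooth2_ex_dx, Hf.
    + auto_derive; easy. }
lra.
Qed.

Lemma Derive_affine (m n : R) (x : R) : Derive (fun z => m * z + n) x = m.
Proof. apply is_derive_unique. auto_derive; [easy | ring]. Qed.

Lemma Derive_lincomb (f g : R -> R) (x t : R) :
  ex_derive f t -> ex_derive g t ->
  Derive (fun z => f z * x + g z) t = Derive f t * x + Derive g t.
Proof.
intros Hf Hg.
rewrite (Derive_plus (fun z => f z * x) g); [| | exact Hg].
- now rewrite Derive_scal_l.
- auto_derive. exact Hf.
Qed.

(** * Prolongations of fields with [w] depending on [t] alone and a second coefficient affine in
    [x] *)

Section AffineField.

Variables (w al be : R -> R).
Hypothesis al1 : forall t, ex_derive al t.
Hypothesis al2 : forall t, ex_derive (Derive al) t.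
Hypothesis be1 : forall t, ex_derive be t.
Hypothesis be2 : forall t, ex_derive (Derive be) t.

Let V := VField (fun t _ => w t) (fun t x => al t * x + be t).

Lemma prol1_affine t x p :
  prol1 V t x p
  = Derive al t * x + Derive be t + (al t - Derive w t) * p.
Proof.
unfold prol1, partial_derive, V; simpl.
rewrite Derive_affine, Derive_const, Derive_lincomb by auto.
change (fun x => w x) with w.
ring.
Qed.

Lemma prol2_affine t x p z :
  prol2 V t x p z
  = Derive_n al 2 t * x + Derive_n be 2 t
    + (2 * Derive al t - Derive_n w 2 t) * p + (al t - 2 * Derive w t) * z.
Proof.
unfold prol2, partial_derive, V; simpl.
(* The inner derivatives are computed in turn for the second partials [U_tx], [U_tt], [U_xx], [w_xx]
   and [w_tx]. *)
rewrite (Derive_ext (fun t => Derive (fun z => al t * z + be t) x) al)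
  by (intros; apply Derive_affine).
rewrite (Derive_ext (Derive (fun t => al t * x + be t))
           (fun t => Derive al t * x + Derive be t))
  by (intros; apply Derive_lincomb; auto).
rewrite (Derive_ext (fun y => Derive (fun z => al t * z + be t) y)
           (fun _ => al t)) by (intros; apply Derive_affine).
rewrite (Derive_ext (fun _ : R => Derive (fun _ => w t) _) (fun _ => 0))
  by (intros; apply Derive_const).
rewrite (Derive_ext (fun t => Derive (fun _ => w t) x) (fun _ => 0))
  by (intros; apply Derive_const).
rewrite Derive_affine, !Derive_const, Derive_lincomb by auto.
change (fun x => w x) with w.
change (Derive (fun y => Derive (fun x => al x) y)) with (Derive (Derive al)).
change (Derive (fun y => Derive (fun x => be x) y)) with (Derive (Derive be)).
ring.
Qed.

End AffineField.

(** * Splitting the admissibility conditions *)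

Lemma determining_xx_zero (r : R) (b c d k w : R -> R) (Y : R -> R -> R) :
  determining_equation r b c d k (VField (fun t _ => w t) Y) ->
  forall t x, partial_derive 0 2 Y t x = 0.
Proof.
intros H t x.
(* Only the undelayed second prolongation contains [p]. The second difference over [p = -1, 0, 1]
   cancels all odd powers of [p] and leaves twice the coefficient of [p ^ 2], namely
   [Y_xx - 2 w_tx]. *)
pose proof (H t x 0 0 0 0) as A0.
pose proof (H t x 1 0 0 0) as A1.
pose proof (H t x (-1) 0 0 0) as A2.
assert (E : partial_derive 1 1 (fun t _ => w t) t x = 0).
{ unfold partial_derive; simpl.
  rewrite (Derive_ext _ (fun _ => 0)) by (intros; apply Derive_const).
  apply Derive_const. }
cbv zeta in A0, A1, A2.
set (X := - (b t * 0 + c t * x + d t * 0 + k t * 0)) in *.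
unfold prol2 at 1 in A0. unfold prol2 at 1 in A1. unfold prol2 at 1 in A2.
cbn [tcoef xcoef] in A0, A1, A2.
rewrite E in A0, A1, A2.
lra.
Qed.

(** One side of the invariance condition is free of [x] and the other is free of [y]. *)
Lemma delay_invariant_tcoef (r : R) (V : vfield) :
  delay_invariant r V ->
  tcoef V = (fun t _ => tcoef V t 0) /\
  forall t, tcoef V (t - r) 0 = tcoef V t 0.
Proof.
intros H. split.
- extensionality t. extensionality x.
  rewrite <- (H t x 0). apply H.
- intros t. apply H.
Qed.

Lemma exists_Derive_neq_0 (k : R -> R) :
  (forall t, ex_derive k t) -> ~ (exists a, forall t, k t = a) ->
  exists t, Derive k t <> 0.
Proof.
intros Hk Hnc. apply NNPP. intros Hno. apply Hnc.
exists (k 0). intros t. apply eq_of_Derive_zero; [exact Hk |].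
intros u. apply NNPP. intros Hu. apply Hno. now exists u.
Qed.

Lemma Derive_shift (f : R -> R) (r t : R) :
  (forall t, ex_derive f t) ->
  Derive (fun t => f (t - r)) t = Derive f (t - r).
Proof.
intros Hf. apply is_derive_unique. auto_derive.
- apply Hf.
- change (fun x => f x) with f. unfold Rminus. ring.
Qed.

Lemma affine_generator (r : R) (b c d k w al be : R -> R) :
  cont_diff c -> cont_diff k -> ~ (exists a, forall t, k t = a) ->
  (forall t, ex_derive w t) -> (forall t, ex_derive (Derive w) t) ->
  (forall t, ex_derive (Derive_n w 2) t) ->
  (forall t, ex_derive al t) -> (forall t, ex_derive (Derive al) t) ->
  (forall t, ex_derive be t) -> (forall t, ex_derive (Derive be) t) ->
  (forall t, w (t - r) = w t) ->
  determining_equation r b c d k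
    (VField (fun t _ => w t) (fun t x => al t * x + be t)) ->
  (forall t, w t = 0) /\ (forall t, al t = al 0) /\ is_solution r b c d k be.
Proof.
intros Hc Hk Hnc w1 w2 w3 al1 al2 be1 be2 per H.
assert (D : forall t x p y q s,
  let X := - (b t * q + c t * x + d t * y + k t * s) in
  (Derive_n al 2 t * x + Derive_n be 2 t
    + (2 * Derive al t - Derive_n w 2 t) * p + (al t - 2 * Derive w t) * X)
  + b t * (Derive al (t - r) * y + Derive be (t - r)
           + (al (t - r) - Derive w (t - r)) * q)
  + c t * (al t * x + be t) + d t * (al (t - r) * y + be (t - r))
  + k t * (Derive_n al 2 (t - r) * y + Derive_n be 2 (t - r)
    + (2 * Derive al (t - r) - Derive_n w 2 (t - r)) * q
    + (al (t - r) - 2 * Derive w (t - r)) * s)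
  + w t * (Derive b t * q + Derive c t * x + Derive d t * y + Derive k t * s)
  = 0).
{ intros t x p y q s X.
  pose proof (H t x p y q s) as E. cbv zeta in E. fold X in E.
  rewrite !prol2_affine, prol1_affine in E by assumption.
  exact E. }
clear H. cbv zeta in D.
(* [D] is affine in [(x, p, y, q, s)], so the coefficient of a variable is the value at 1 minus the
   value at 0, with the other variables 0. Here the variable is [p]. *)
assert (alw : forall t, 2 * Derive al t = Derive_n w 2 t).
{ intros t. pose proof (D t 0 0 0 0 0). pose proof (D t 0 1 0 0 0). lra. }
assert (dper : forall t, Derive w (t - r) = Derive w t).
{ intros t. rewrite <- Derive_shift by assumption.
  apply Derive_ext. exact per. }
(* By [alw], [2 * al - Derive w] is constant; since [Derive w] is [r]-periodic, so is [al]. *)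
assert (aper : forall t, al (t - r) = al t).
{ intros t.
  assert (E : 2 * al (t - r) - Derive w (t - r) = 2 * al t - Derive w t).
  { apply (eq_of_Derive_zero (fun t => 2 * al t - Derive w t)).
    - intros u. apply (ex_derive_minus (fun t => 2 * al t) (Derive w)); auto.
      apply ex_derive_scal; auto.
    - intros u. rewrite (Derive_minus (fun t => 2 * al t) (Derive w)); auto.
      + rewrite Derive_scal, alw. apply Rminus_diag_eq. reflexivity.
      + apply ex_derive_scal; auto. }
  rewrite dper in E. lra. }
(* In the coefficient of [s], the multiples of [k t] are [al - 2 * Derive w] at [t - r] minus the
   same at [t]; they cancel by periodicity. *)
assert (wk : forall t, w t * Derive k t = 0).
{ intros t. pose proof (D t 0 0 0 0 0). pose proof (D t 0 0 0 0 1).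
  pose proof (aper t). pose proof (dper t). nra. }
assert (xeq : forall t,
  Derive_n al 2 t + 2 * c t * Derive w t + w t * Derive c t = 0).
{ intros t. pose proof (D t 0 0 0 0 0). pose proof (D t 1 0 0 0 0). nra. }
assert (w3eq : forall t,
  Derive (Derive_n w 2) t = - 4 * c t * Derive w t + - 2 * Derive c t * w t).
{ intros t.
  assert (E : Derive (Derive_n w 2) t = 2 * Derive_n al 2 t).
  { rewrite <- (Derive_ext (fun t => 2 * Derive al t)) by exact alw.
    rewrite Derive_scal. reflexivity. }
  pose proof (xeq t). lra. }
assert (w0 : forall t, w t = 0).
{ destruct (exists_Derive_neq_0 k) as [t0 Ht0]; [apply Hk | exact Hnc |].
  (* Continuity keeps [Derive k] nonzero near [t0]. Vanishing on a neighbourhood gives all three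
     initial values [w], [w'], [w''] at [t0]. *)
  assert (loc : locally t0 (fun t => w t = 0)).
  { apply (filter_imp (fun t => Derive k t <> 0));
      [| exact (proj2 (Hk t0) _ (open_neq 0 _ Ht0))].
    intros t Ht.
    destruct (Rmult_integral _ _ (wk t)); [assumption | contradiction]. }
  apply (third_order_linear_zero w (Derive w) (Derive_n w 2)
           (fun t => - 4 * c t) (fun t => - 2 * Derive c t) t0).
  - intros t. apply Derive_correct, w1.
  - intros t. apply Derive_correct, w2.
  - intros t. rewrite <- w3eq. apply Derive_correct, w3.
  - intros t. apply (continuous_scal_r (-4) c), (ex_derive_continuous c), Hc.
  - intros t. apply (continuous_scal_r (-2) (Derive c)), Hc.
  - exact (locally_singleton _ _ loc).
  - rewrite (Derive_ext_loc w (fun _ => 0) t0 loc). apply Derive_const.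
  - rewrite (Derive_n_ext_loc w (fun _ => 0) 2 t0 loc).
    apply Derive_n_const. }
assert (Ew : w = fun _ => 0) by (extensionality t; apply w0).
split; [exact w0 |]. split.
- intros t. apply eq_of_Derive_zero; [exact al1 |].
  intros u. pose proof (alw u) as E.
  rewrite Ew, Derive_n_const in E. simpl in E. lra.
- split.
  + intros t. auto.
  (* With all jet variables 0, only the terms in [be] survive, and they form the delay equation for
     [be]. *)
  + intros t. pose proof (D t 0 0 0 0 0) as E.
    rewrite Ew, !Derive_const in E. nra.
Qed.

(** * Admissibility of the listed fields, and the classification *)

Lemma scaling_translation_admitted (r a1 a2 : R) (b c d k rho : R -> R) :
  is_solution r b c d k rho ->
  admitted_generator r b c d k
    (VField (fun _ _ => 0) (fun t x => a1 * x + a2 * rho t)).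
Proof.
intros [Hrho Heq]. split.
- intros t x y. reflexivity.
- intros t x p y q s X.
  assert (D1 : forall t, Derive (fun t => a2 * rho t) t = a2 * Derive rho t)
    by (intros; apply Derive_scal).
  assert (D2 : forall t,
    Derive_n (fun t => a2 * rho t) 2 t = a2 * Derive_n rho 2 t)
    by (intros; apply Derive_n_scal_l).
  assert (S1 : forall t, ex_derive (fun t => a2 * rho t) t)
    by (intros; apply ex_derive_scal, Hrho).
  assert (S2 : forall t, ex_derive (Derive (fun t => a2 * rho t)) t).
  { intros u. apply (ex_derive_ext (fun t => a2 * Derive rho t)).
    - intros; symmetry; apply D1.
    - apply ex_derive_scal, Hrho. }
  assert (C2 : forall t, ex_derive (Derive (fun _ => a1)) t).
  { intros u. apply (ex_derive_ext (fun _ => 0)).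
    - intros; symmetry; apply Derive_const.
    - apply ex_derive_const. }
  pose proof (prol1_affine (fun _ => 0) (fun _ => a1) (fun t => a2 * rho t)
    (fun t => ex_derive_const a1 t) S1) as P1.
  pose proof (prol2_affine (fun _ => 0) (fun _ => a1) (fun t => a2 * rho t)
    (fun t => ex_derive_const a1 t) C2 S1 S2) as P2.
  cbv beta in P1, P2.
  rewrite !P2, P1. cbn [tcoef xcoef].
  rewrite !D1, !D2, !Derive_n_const, !Derive_const. cbv iota.
  pose proof (Heq t) as E. unfold X.
  (* The [a1] terms add up to [a1 * (X + b t * q + c t * x + d t * y + k t * s)], which is 0 by the
     choice of [X]. *)
  transitivity (a2 * (Derive_n rho 2 t + b t * Derive rho (t - r)
    + c t * rho t + d t * rho (t - r) + k t * Derive_n rho 2 (t - r))).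
  + ring.
  + rewrite E. ring.
Qed.

Theorem theorem3p3 :
  forall (r : R) (b c d k : R -> R),
    0 < r ->
    cont_diff b -> cont_diff c -> cont_diff d -> cont_diff k ->
    ~ (exists a : R, forall t : R, k t = a) ->
    forall V : vfield,
      smooth_vfield V ->
      (admitted_generator r b c d k V <->
       exists (a1 a2 : R) (rho : R -> R),
         is_solution r b c d k rho /\
         vf_eq V (vf_add (vf_scal a1 zeta1) (vf_scal a2 (zeta2 rho)))).
Proof.
intros r b c d k _ _ Hc _ Hk Hnc [W Y] [HW HY]. simpl in HW, HY.
split.
- intros [Hinv Hdet].
  destruct (delay_invariant_tcoef r _ Hinv) as [EW per].
  cbn [tcoef] in EW, per.
  set (w := fun t => W t 0).
  change (W = fun t _ => w t) in EW.
  rewrite EW in Hdet.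
  pose proof (smooth2_affine Y HY (determining_xx_zero r b c d k w Y Hdet)) as HYa.
  set (al := fun t => Derive (Y t) 0).
  set (be := fun t => Y t 0).
  assert (EY : Y = fun t x => al t * x + be t)
    by (extensionality t; extensionality x; apply HYa).
  rewrite EY in Hdet.
  pose proof (smooth2_dx Y HY) as HYx.
  destruct (affine_generator r b c d k w al be) as [Zw [Ca Sb]]; auto.
  (* [w], [al] and [be] are the restrictions to [x = 0] of the smooth functions [W], [Y_x] and [Y],
     which supplies their derivatives in [t]. *)
  + intros t. exact (smooth2_ex_dt W 0 t HW).
  + intros t. exact (smooth2_ex_dt _ 0 t (smooth2_dt W HW)).
  + intros t. exact (smooth2_ex_dt _ 0 t (smooth2_dt _ (smooth2_dt W HW))).
  + intros t. exact (smooth2_ex_dt _ 0 t HYx).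
  + intros t. exact (smooth2_ex_dt _ 0 t (smooth2_dt _ HYx)).
  + intros t. exact (smooth2_ex_dt Y 0 t HY).
  + intros t. exact (smooth2_ex_dt _ 0 t (smooth2_dt Y HY)).
  (* The constant value of [al] is the scaling coefficient; [be] is itself a solution, so its factor
     is 1. *)
  + exists (al 0), 1, be. split; [exact Sb |].
    intros t x. cbn [tcoef xcoef vf_add vf_scal zeta1 zeta2]. split.
    * rewrite EW, Zw. ring.
    * rewrite EY, Ca. ring.
- intros (a1 & a2 & rho & Hrho & HV).
  assert (EW : forall t x, W t x = a1 * 0 + a2 * 0) by apply HV.
  assert (EY : forall t x, Y t x = a1 * x + a2 * rho t) by apply HV.
  replace W with (fun _ _ : R => 0)
    by (extensionality t; extensionality x; rewrite EW; ring).
  replace Y with (fun t x => a1 * x + a2 * rho t)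
    by (extensionality t; extensionality x; now rewrite EY).
  now apply scaling_translation_admitted.
Qed.
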